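(* Given any two (complex valued) solenoidal vector fields $u(t,x)$ and $v(t,x)$ on $\mathbb{R}_+\times\mathbb{R}^3$, there exist symmetric solenoidal vector fields $u^\alpha$ and $v^{\alpha}$ ($\alpha\in\{0,1\}^3$) with $u=\sum_{\alpha\in\{0,1\}^3}u^\alpha$ and $v=\sum_{\alpha'\in\{0,1\}^3}v^{\alpha'}$ such that all the $B(u^\alpha,v^{\alpha'})$, $\alpha,\alpha'\in\{0,1\}^3$, have symmetric properties and $$B(u,v)=\sum_{\alpha,\alpha'\in\{0,1\}^3}B(u^\alpha,v^{\alpha'}).$$
   Context: A real function $f$ (of $x\in\mathbb{R}^3$, possibly depending also on $t$) is symmetric if for some $\alpha\in\{0,1\}^3$ it has the same symmetry in $x$ as the monomial $x^\alpha$, i.e. $f((-1)^{\gamma_1}x_1,(-1)^{\gamma_2}x_2,(-1)^{\gamma_3}x_3)=(-1)^{\gamma_1\alpha_1+\gamma_2\alpha_2+\gamma_3\alpha_3}f(x)$ for all $\gamma\in\{0,1\}^3$ and all $x$ (and $t$). A complex vector field is symmetric (has symmetric property) if the real part and the imaginary part of each of its three components are symmetric. Solenoidal means divergence zero in $x$. $B(u,v)(t,x)=\int_0^te^{(t-s)\Delta}\mathbb{P}\nabla(u\otimes v)\,ds$, where $\mathbb{P}\nabla(u\otimes v)=u\cdot\nabla v+(-\Delta)^{-1}\nabla G(u,v)$ and $G(u,v)=\sum_{l,l'=1}^3\partial_l\partial_{l'}(u_lv_{l'})$ (complex bilinear, no conjugation). The vector fields are assumed such that these expressions are well defined. *)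

(* Defs.v *)
From HB Require Import structures.
From mathcomp Require Import all_boot all_order all_algebra.
From mathcomp Require Import complex.
From mathcomp Require Import all_classical all_reals all_analysis.

Set Implicit Arguments.
Unset Strict Implicit.
Unset Printing Implicit Defensive.

Import Order.TTheory GRing.Theory Num.Theory.
Import numFieldNormedType.Exports.

Local Open Scope classical_set_scope.
Local Open Scope ring_scope.

(* R^3 is the product R * R * R, which carries both the normed-module structure
   needed for partial derivatives and the product Lebesgue measure. The library
   norm on it is the sup norm; the Euclidean norm is [enorm]. *)
Notation parity := {ffun 'I_3 -> bool}.

Section Space.
Variable R : realType.

Definition coord (x : R * R * R) (l : 'I_3) : R :=
  [:: x.1.1; x.1.2; x.2]`_l.

Definition of_coord (f : 'I_3 -> R) : R * R * R :=
  (f (inord 0), f (inord 1), f (inord 2)).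

Definition basis (l : 'I_3) : R * R * R := of_coord (fun k => (k == l)%:R).

Definition enorm (x : R * R * R) : R := Num.sqrt (\sum_(l < 3) coord x l ^+ 2).

Definition flip (g : parity) (x : R * R * R) : R * R * R :=
  of_coord (fun l => (-1) ^+ g l * coord x l).

Definition volume :
    {measure set (measurableTypeR R * measurableTypeR R * measurableTypeR R)%type
       -> \bar R} :=
  ((@lebesgue_measure R \x @lebesgue_measure R) \x @lebesgue_measure R)%E.

End Space.

(* Derivatives and integrals of complex-valued functions are taken on the real
   and imaginary parts. The operators are total; the [*able] predicates say when
   their value is meaningful. *)
Section ComplexCalculus.
Variable R : realType.

Definition pderivable (l : 'I_3) (f : R * R * R -> R[i]) (x : R * R * R) : Prop :=
  derivable (fun y => complex.Re (f y)) x (basis R l) /\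
  derivable (fun y => complex.Im (f y)) x (basis R l).

Definition pderive (l : 'I_3) (f : R * R * R -> R[i]) (x : R * R * R) : R[i] :=
  Complex ('D_(basis R l) (fun y => complex.Re (f y)) x)
          ('D_(basis R l) (fun y => complex.Im (f y)) x).

Definition cintegrable d (T : measurableType d) (mu : {measure set T -> \bar R})
    (D : set T) (f : T -> R[i]) : Prop :=
  integrable mu D (fun y => (complex.Re (f y))%:E) /\
  integrable mu D (fun y => (complex.Im (f y))%:E).

Definition cintegral d (T : measurableType d) (mu : {measure set T -> \bar R})
    (D : set T) (f : T -> R[i]) : R[i] :=
  Complex (Rintegral mu D (fun y => complex.Re (f y)))
          (Rintegral mu D (fun y => complex.Im (f y))).

Definition convolvable (k : R * R * R -> R) (f : R * R * R -> R[i])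
    (x : R * R * R) : Prop :=
  cintegrable (@volume R) setT (fun y => (k (x - y))%:C%C * f y).

Definition convolve (k : R * R * R -> R) (f : R * R * R -> R[i])
    (x : R * R * R) : R[i] :=
  cintegral (@volume R) setT (fun y => (k (x - y))%:C%C * f y).

Definition heat_kernel (t : R) (x : R * R * R) : R :=
  expR (- (enorm x ^+ 2 / (4 * t))) / Num.sqrt (4 * pi * t) ^+ 3.

(* Fundamental solution of -Delta on R^3; its value 0 at the origin (division by
   zero) is irrelevant for the integrals. *)
Definition newton_kernel (x : R * R * R) : R := (4 * pi * enorm x)^-1.

Definition heat (t : R) : (R * R * R -> R[i]) -> R * R * R -> R[i] :=
  convolve (heat_kernel t).

Definition inv_neg_laplacian : (R * R * R -> R[i]) -> R * R * R -> R[i] :=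
  convolve newton_kernel.

End ComplexCalculus.

(* A time-dependent complex vector field: [u t x l] is the l-th component.
   R_+ is ]0, +oo[: values at t <= 0 are never used. *)
Definition field (R : realType) : Type := R -> R * R * R -> 'I_3 -> R[i].

Section Fields.
Variable R : realType.
Implicit Types u v : field R.

Definition solenoidal u : Prop :=
  forall (t : R) (x : R * R * R), 0 < t ->
    (forall l : 'I_3, pderivable l (fun y => u t y l) x) /\
    \sum_(l < 3) pderive l (fun y => u t y l) x = 0.

Definition symmetric_fun (f : R -> R * R * R -> R) : Prop :=
  exists a : parity, forall (g : parity) (t : R) (x : R * R * R), 0 < t ->
    f t (flip g x) = (-1) ^+ (\sum_(l < 3) g l * a l)%N * f t x.

Definition symmetric_field u : Prop :=
  forall j : 'I_3,
    symmetric_fun (fun t x => complex.Re (u t x j)) /\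
    symmetric_fun (fun t x => complex.Im (u t x j)).

(* Image of a vector field under the orthogonal reflection [flip g]. A field is a
   combination of its symmetric parts, which are combinations of its reflections;
   so all the B of symmetric parts make sense as soon as B makes sense on the
   reflections of both arguments. That B u v alone makes sense is not enough:
   u and v may have disjoint supports while u and a reflection of v do not. *)
Definition reflect_field (g : parity) u : field R :=
  fun t x j => (-1) ^+ g j * u t (flip g x) j.

Definition Gterm u v (t : R) (x : R * R * R) : R[i] :=
  \sum_(l < 3) \sum_(m < 3)
    pderive l (pderive m (fun y => u t y l * v t y m)) x.

Definition proj_div u v : field R := fun t x j =>
  \sum_(l < 3) u t x l * pderive l (fun y => v t y j) x
  + inv_neg_laplacian (pderive j (Gterm u v t)) x.

Definition B u v : field R := fun t x j =>
  cintegral (@lebesgue_measure R) `]0, t[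
    (fun s => heat (t - s) (fun y => proj_div u v s y j) x).

(* Every derivative occurring in [B u v] exists and every integral occurring in
   it converges absolutely. *)
Definition B_well_defined u v : Prop :=
  [/\ forall (s : R) (x : R * R * R), 0 < s ->
        [/\ forall l j : 'I_3, pderivable l (fun y => v s y j) x,
            forall l m : 'I_3, pderivable m (fun y => u s y l * v s y m) x,
            forall l m : 'I_3,
              pderivable l (pderive m (fun y => u s y l * v s y m)) x
          & forall j : 'I_3, pderivable j (Gterm u v s) x],
      forall (s : R) (x : R * R * R) (j : 'I_3), 0 < s ->
        convolvable (@newton_kernel R) (pderive j (Gterm u v s)) x,
      forall (s t : R) (x : R * R * R) (j : 'I_3), 0 < s -> s < t ->
        convolvable (heat_kernel (t - s)) (fun y => proj_div u v s y j) x
    & forall (t : R) (x : R * R * R) (j : 'I_3), 0 < t ->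
        cintegrable (@lebesgue_measure R) `]0, t[
          (fun s => heat (t - s) (fun y => proj_div u v s y j) x)].

End Fields.

(* Main.v *)
Require Import Defs.
From HB Require Import structures.
From mathcomp Require Import all_boot all_order all_algebra.
From mathcomp Require Import complex.
From mathcomp Require Import all_classical all_reals all_analysis.
From mathcomp Require Import measurable_realfun.

(** The group of the eight coordinate reflections acts on vector fields by
    [reflect_field]. Averaging a field [w] over this group against the character
    [g |-> (-1) ^+ (g . a)] gives its symmetric part of type [a]: a field that each
    reflection multiplies by the value of the character
    ([reflect_symmetric_part]). Such a field is symmetric in the required sense,
    its [j]-th component having the parity of [x^a] times [x_j]
    ([symmetric_field_reflect]). By orthogonality of the characters the symmetric
    parts add up to [w] ([sum_symmetric_part]), and they are solenoidal since the
    divergence is linear and commutes with reflections.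

    Two properties of [B] then give the result. It is bilinear on finite
    combinations whose terms make sense pairwise ([B_well_defined_lincomb],
    [B_lincomb]): this gives a meaning to [B] on symmetric parts, which are
    combinations of reflections, and splits [B u v] into the sum over pairs of
    symmetric parts. It also commutes with simultaneous reflection of both
    arguments ([B_reflect]), because a reflection is a linear isometry preserving
    the volume while the heat and Newton kernels are radial. Reflecting
    [B (ua a) (va a')] therefore multiplies it by the product of the characters of
    [a] and [a'], which is again a character, so this field is symmetric too. *)

Set Implicit Arguments.
Unset Strict Implicit.
Unset Printing Implicit Defensive.

Import Order.TTheory GRing.Theory Num.Theory.
Import numFieldNormedType.Exports.
(* [basis] and [coord] also name notions of topology and of linear algebra. *)
Import Defs.

Local Open Scope classical_set_scope.
Local Open Scope ring_scope.

(** * Operators linear on a domain *)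

Section PartialLinear.
Context {R : realType} {T : Type}.

Definition lincomb (I : finType) (c : I -> R) (f : I -> T -> R[i]) : T -> R[i] :=
  fun y => \sum_i (c i)%:C%C * f i y.

(** Partial derivatives at a point, integrals and convolutions at a point are all
    total functionals [L] that are linear only on the set [dom] of functions
    where their value is meaningful. Stating closure of [dom] and linearity of
    [L] together, for a whole finite combination, lets a composite operator such
    as [B] be treated one layer at a time. The scalars are real, so that they
    pass through real and imaginary parts. *)
Definition partial_linear (dom : (T -> R[i]) -> Prop) (L : (T -> R[i]) -> R[i]) :=
  forall (I : finType) (c : I -> R) (f : I -> T -> R[i]),
    (forall i, dom (f i)) ->
    dom (lincomb c f) /\ L (lincomb c f) = \sum_i (c i)%:C%C * L (f i).

(** Derivatives and integrals of complex functions act separately on real and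
    imaginary parts; a real scalar does the same, so real linearity suffices. *)
Lemma partial_linear_complexify (dom0 : (T -> R) -> Prop) (L0 : (T -> R) -> R) :
  dom0 (fun=> 0) ->
  (forall (a : R) f g, dom0 f -> dom0 g ->
    dom0 (fun y => a * f y + g y) /\ L0 (fun y => a * f y + g y) = a * L0 f + L0 g) ->
  partial_linear
    (fun f => dom0 (fun y => complex.Re (f y)) /\ dom0 (fun y => complex.Im (f y)))
    (fun f => Complex (L0 (fun y => complex.Re (f y))) (L0 (fun y => complex.Im (f y)))).
Proof.
move=> dom00 linL0 I c f domf.
(* Applying linearity to 1 * 0 + 0 gives L0 0 = L0 0 + L0 0. *)
have L00 : L0 (fun=> 0) = 0.
  have [_] := linL0 1 _ _ dom00 dom00.
  under eq_fun do rewrite mulr0 addr0.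
  by rewrite mul1r => /eqP; rewrite eq_sym -subr_eq0 addrK => /eqP.
have Lsum (s : seq I) (g : I -> T -> R) : (forall i, dom0 (g i)) ->
    dom0 (fun y => \sum_(i <- s) c i * g i y) /\
    L0 (fun y => \sum_(i <- s) c i * g i y) = \sum_(i <- s) c i * L0 (g i).
  move=> domg; elim: s => [|i s [dom_s L_s]].
    by under eq_fun do rewrite big_nil; rewrite big_nil.
  under eq_fun do rewrite big_cons.
  by rewrite big_cons -L_s; exact: linL0.
have -> : (fun y => complex.Re (lincomb c f y)) =
    (fun y => \sum_i c i * complex.Re (f i y)).
  apply/funext => y; rewrite (raddf_sum (@complex.Re R : Rcomplex R -> R)).
  by apply: eq_bigr => i _; case: (f i y) => a b /=; rewrite mul0r subr0.
have -> : (fun y => complex.Im (lincomb c f y)) =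
    (fun y => \sum_i c i * complex.Im (f i y)).
  apply/funext => y; rewrite (raddf_sum (@complex.Im R : Rcomplex R -> R)).
  by apply: eq_bigr => i _; case: (f i y) => a b /=; rewrite mul0r addr0.
have [domRe ->] := Lsum (index_enum I) _ (fun i => (domf i).1).
have [domIm ->] := Lsum (index_enum I) _ (fun i => (domf i).2).
split=> //; elim: (index_enum I) => [|i s IH]; first by rewrite !big_nil.
by rewrite !big_cons -IH; simpc.
Qed.

Lemma partial_linear_scale dom L (c : R) (f : T -> R[i]) :
  partial_linear dom L -> dom f ->
  dom (fun y => c%:C%C * f y) /\ L (fun y => c%:C%C * f y) = c%:C%C * L f.
Proof.
move=> linL domf.
have [] := linL unit (fun=> c) (fun=> f) (fun=> domf).
have -> : lincomb (fun _ : unit => c) (fun=> f) = (fun y => c%:C%C * f y).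
  by apply/funext => y; rewrite /lincomb big_const card_unit /= addr0.
by rewrite big_const card_unit /= addr0.
Qed.

End PartialLinear.

Section LinearOperators.
Context {R : realType}.

Lemma pderive_linear (l : 'I_3) (x : R * R * R) :
  partial_linear (fun f => pderivable l f x) (fun f => pderive l f x).
Proof.
refine (@partial_linear_complexify R (R * R * R)%type
  (fun f => derivable f x (basis R l)) (fun f => 'D_(basis R l) f x) _ _).
  exact: derivable_cst.
move=> a f g df dg; have daf := derivableZ (k := a) df.
have -> : (fun y => a * f y + g y) = (a \*: (f : _ -> R^o)) + g by apply/funext.
by split; [exact: derivableD|rewrite deriveD // deriveZ].
Qed.

Lemma cintegral_linear d (T : measurableType d) (mu : {measure set T -> \bar R})
    (D : set T) : measurable D ->
  partial_linear (cintegrable mu D) (cintegral mu D).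
Proof.
move=> mD.
refine (@partial_linear_complexify R T
  (fun f => mu.-integrable D (EFin \o f)) (Rintegral mu D) _ _).
  exact: integrable0.
move=> a f g intf intg.
have intaf : mu.-integrable D (EFin \o (fun y => a * f y))
  by exact: (integrableZl mD a intf).
split; first exact: (integrableD mD intaf intg).
by rewrite RintegralD // RintegralZl.
Qed.

Lemma convolve_linear (k : R * R * R -> R) (x : R * R * R) :
  partial_linear (fun f => convolvable k f x) (fun f => convolve k f x).
Proof.
move=> I c f domf.
have E : (fun y => (k (x - y))%:C%C * lincomb c f y) =
    lincomb c (fun i y => (k (x - y))%:C%C * f i y).
  apply/funext => y; rewrite /lincomb mulr_sumr.
  by apply: eq_bigr => i _; rewrite mulrCA.
rewrite /convolvable /convolve E.
exact: (cintegral_linear (mu := @volume R) measurableT c domf).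
Qed.

End LinearOperators.

(** * Coordinate reflections *)

Section Flip.
Context {R : realType}.
Implicit Types (x : R * R * R) (h : parity).

(** Identities between points are checked coordinate by coordinate through this
    lemma, since every coordinate of a reflection has the same expression. *)
Lemma coord_inj x y : (forall l, coord x l = coord y l) -> x = y.
Proof.
case: x => [[x0 x1] x2]; case: y => [[y0 y1] y2] xy.
by congr (_, _, _); [have := xy (inord 0)|have := xy (inord 1)|have := xy (inord 2)];
  rewrite /coord /= inordK.
Qed.

Lemma coord_of_coord (f : 'I_3 -> R) l : coord (of_coord f) l = f l.
Proof.
by rewrite -[l]inord_val /coord; case: l => [[|[|[|//]]] ?] /=; rewrite inordK.
Qed.

Lemma coord_flip h x l : coord (flip h x) l = (-1) ^+ h l * coord x l.
Proof. by rewrite coord_of_coord. Qed.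

Lemma coordD x y l : coord (x + y) l = coord x l + coord y l.
Proof. by rewrite /coord; case: l => [[|[|[|//]]] ?]. Qed.

Lemma coordN x l : coord (- x) l = - coord x l.
Proof. by rewrite /coord; case: l => [[|[|[|//]]] ?]. Qed.

Lemma coordZ (a : R) x l : coord (a *: x) l = a * coord x l.
Proof. by rewrite /coord; case: l => [[|[|[|//]]] ?]. Qed.

Lemma flipD h x y : flip h (x + y) = flip h x + flip h y.
Proof.
by apply: coord_inj => l; rewrite !(coord_flip, coordD) mulrDr.
Qed.

Lemma flipN h x : flip h (- x) = - flip h x.
Proof. by apply: coord_inj => l; rewrite !(coord_flip, coordN) mulrN. Qed.

Lemma flipZ h (a : R) x : flip h (a *: x) = a *: flip h x.
Proof.
by apply: coord_inj => l; rewrite !(coord_flip, coordZ) mulrCA.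
Qed.

Lemma flip_comp h g x : flip h (flip g x) = flip [ffun l => h l (+) g l] x.
Proof.
by apply: coord_inj => l; rewrite !coord_flip ffunE mulrA -signr_addb.
Qed.

Lemma flip0 x : flip [ffun=> false] x = x.
Proof. by apply: coord_inj => l; rewrite coord_flip ffunE mul1r. Qed.

Lemma flip_basis h l : flip h (basis R l) = (-1) ^+ h l *: basis R l.
Proof.
apply: coord_inj => k; rewrite coord_flip coordZ coord_of_coord.
by have [->|] := eqVneq k l; rewrite ?mulr0.
Qed.

Lemma enorm_flip h x : enorm (flip h x) = enorm x.
Proof.
by congr Num.sqrt; apply: eq_bigr => l _; rewrite coord_flip exprMn sqrr_sign mul1r.
Qed.

Lemma heat_kernel_flip t h x : heat_kernel t (flip h x) = heat_kernel t x.
Proof. by rewrite /heat_kernel enorm_flip. Qed.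

Lemma newton_kernel_flip h x : newton_kernel (flip h x) = newton_kernel x.
Proof. by rewrite /newton_kernel enorm_flip. Qed.

Lemma flipE h x : flip h x =
  ((-1) ^+ h (inord 0) * x.1.1, (-1) ^+ h (inord 1) * x.1.2,
   (-1) ^+ h (inord 2) * x.2).
Proof. by rewrite /flip /of_coord /coord !inordK. Qed.

End Flip.

Section FlipDerivative.
Context {R : realType}.
Implicit Types (x : R * R * R) (h : parity).

(** The difference quotient in the direction [- v] at [t] is minus the one in the
    direction [v] at [- t], and [t |-> - t] maps punctured neighbourhoods of 0 to
    punctured neighbourhoods of 0. *)
Lemma is_deriveN_direction (V W : normedModType R) (f : V -> W) (x v : V) :
  derivable f x v -> is_derive x (- v) f (- 'D_v f x).
Proof.
move=> df.
suff H : (fun t => t^-1 *: ((f \o shift x) (t *: - v) - f x)) @ 0^' --> - 'D_v f x.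
  by split; [apply/cvg_ex; exists (- 'D_v f x)|exact/cvg_lim].
have -> : (fun t => t^-1 *: ((f \o shift x) (t *: - v) - f x)) =
    (fun t => - (t^-1 *: ((f \o shift x) (t *: v) - f x))) \o -%R.
  by apply/funext => t /=; rewrite invrN scaleNr scalerN scaleNr opprK.
apply: (cvg_comp _ _ _ (cvgN df)).
move=> A [e e0 eA]; exists e => //= y ye y0; apply: eA; last by rewrite oppr_eq0.
by move: ye; rewrite /= !sub0r opprK normrN.
Qed.

(** Chain rule for a linear isometry, valid under mere directional derivability:
    the difference quotient of [f \o flip h] along a basis vector is exactly that
    of [f] along its image, which is plus or minus the same basis vector. *)
Lemma is_derive_flip (W : normedModType R) (f : R * R * R -> W) x h l :
  derivable f (flip h x) (basis R l) ->
  is_derive x (basis R l) (f \o flip h)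
    ((-1) ^+ h l *: 'D_(basis R l) f (flip h x)).
Proof.
move=> df.
have [df' Df'] : is_derive (flip h x) (flip h (basis R l)) f
    ((-1) ^+ h l *: 'D_(basis R l) f (flip h x)).
  rewrite flip_basis; case: (h l) => /=.
    by rewrite expr1 !scaleN1r; exact: is_deriveN_direction.
  by rewrite expr0 !scale1r; exact: derivableP.
have E : (fun t : R => t^-1 *: (((f \o flip h) \o shift x) (t *: basis R l)
                           - (f \o flip h) x)) =
  (fun t : R => t^-1 *: ((f \o shift (flip h x)) (t *: flip h (basis R l))
                           - f (flip h x))).
  by apply/funext => t /=; rewrite flipD flipZ.
by split; rewrite /derivable /derive E.
Qed.

Lemma pderive_flip (f : R * R * R -> R[i]) x h l :
  pderivable l f (flip h x) ->
  pderivable l (f \o flip h) x /\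
  pderive l (f \o flip h) x = ((-1) ^+ h l)%:C%C * pderive l f (flip h x).
Proof.
move=> [dRe dIm].
have [dRe' DRe] := is_derive_flip dRe.
have [dIm' DIm] := is_derive_flip dIm.
split; first exact: (conj dRe' dIm').
by apply/eqP; rewrite eq_complex /= DRe DIm !mul0r subr0 addr0 !eqxx.
Qed.

End FlipDerivative.

Section FlipVolume.
Context {R : realType}.
Local Open Scope ereal_scope.

Definition measure_preserving d (T : measurableType d)
    (mu : {measure set T -> \bar R}) (phi : T -> T) :=
  measurable_fun setT phi /\
  forall A, measurable A -> mu (phi @^-1` A)%classic = mu A.

Lemma measure_preserving_sign (b : bool) :
  measure_preserving (@lebesgue_measure R)
    ((fun a => (-1) ^+ b * a)%R : measurableTypeR R -> measurableTypeR R).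
Proof.
case: b.
  have -> : (fun a => (-1) ^+ true * a)%R = -%R :> (measurableTypeR R -> _).
    by apply/funext => a; rewrite expr1 mulN1r.
  split=> [|A mA]; first exact: oppr_measurable.
  exact: lebesgue_measureN.
have -> : (fun a => (-1) ^+ false * a)%R = id :> (measurableTypeR R -> _).
  by apply/funext => a; rewrite expr0 mul1r.
by split=> //; exact: measurable_id.
Qed.

Lemma ge0_integral_measure_preserving d (T : measurableType d)
    (mu : {measure set T -> \bar R}) (phi : T -> T) (f : T -> \bar R) :
  measure_preserving mu phi -> measurable_fun setT f -> (forall x, 0 <= f x) ->
  \int[mu]_x f (phi x) = \int[mu]_x f x.
Proof.
move=> [mphi pres] mf f0.
rewrite -[LHS](ge0_integral_pushforward mphi mu measurableT mf) //.
by apply: eq_measure_integral => A mA _; exact: pres.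
Qed.

(** The section at [x] of the preimage of [A] is the preimage under [p2] of the
    section of [A] at [p1 x]. Hence the measure of the preimage is the integral of
    the measures of the sections of [A] precomposed with [p1], and [p1] may be
    dropped. *)
Lemma measure_preserving_prod d1 d2 (T1 : measurableType d1) (T2 : measurableType d2)
    (m1 : {measure set T1 -> \bar R})
    (m2 : {sigma_finite_measure set T2 -> \bar R}) (p1 : T1 -> T1) (p2 : T2 -> T2) :
  measure_preserving m1 p1 -> measure_preserving m2 p2 ->
  measure_preserving (m1 \x m2) (fun z => (p1 z.1, p2 z.2)).
Proof.
move=> pres1 [mp2 pres2]; have [mp1 _] := pres1.
split; first by apply: measurable_fun_pair; exact: measurableT_comp.
move=> A mA; rewrite /product_measure1 /=.
rewrite -[RHS](ge0_integral_measure_preserving pres1) //; last first.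
  exact: measurable_fun_xsection.
apply: eq_integral => x _ /=; rewrite -[RHS]pres2; last exact: measurable_xsection.
by congr (m2 _); apply/seteqP; split => y; rewrite /xsection /= !inE.
Qed.

Lemma measure_preserving_flip (h : parity) :
  measure_preserving (@volume R) (@flip R h).
Proof.
have -> : @flip R h = (fun x => ((-1) ^+ h (inord 0) * x.1.1,
    (-1) ^+ h (inord 1) * x.1.2, (-1) ^+ h (inord 2) * x.2))%R.
  by apply/funext => x; exact: flipE.
have pres01 := measure_preserving_prod (measure_preserving_sign (h (inord 0)))
  (measure_preserving_sign (h (inord 1))).
exact: (measure_preserving_prod pres01 (measure_preserving_sign (h (inord 2)))).
Qed.

Lemma integral_measure_preserving d (T : measurableType d)
    (mu : {measure set T -> \bar R}) (phi : T -> T) (f : T -> \bar R) :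
  measure_preserving mu phi -> mu.-integrable setT f ->
  mu.-integrable setT (f \o phi) /\
  \int[mu]_x (f \o phi) x = \int[mu]_x f x.
Proof.
move=> pres intf; have [mphi presE] := pres; have [mf finf] := integrableP _ _ _ intf.
have intfp : mu.-integrable setT (f \o phi).
  apply/integrableP; split; first exact: measurableT_comp.
  rewrite (ge0_integral_measure_preserving (f := fun x => `|f x|) pres) //.
  exact: measurableT_comp.
split=> //; have -> := esym (integral_pushforward mphi mf intfp measurableT).
by apply: eq_measure_integral => A mA _; exact: presE.
Qed.

Lemma cintegral_measure_preserving d (T : measurableType d)
    (mu : {measure set T -> \bar R}) (phi : T -> T) (f : T -> R[i]) :
  measure_preserving mu phi -> cintegrable mu setT f ->
  cintegrable mu setT (f \o phi) /\
  cintegral mu setT (f \o phi) = cintegral mu setT f.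
Proof.
move=> pres [intRe intIm].
have [intRe' ReE] := integral_measure_preserving pres intRe.
have [intIm' ImE] := integral_measure_preserving pres intIm.
split; first by split.
by rewrite /cintegral /Rintegral -ReE -ImE.
Qed.

(** Change of variables [y |-> flip h y]: it preserves the volume, and by linearity
    of the reflection [k (x - flip h y) = k (flip h x - y)] for an invariant kernel
    [k]. *)
Lemma convolve_flip (k : R * R * R -> R) (f : R * R * R -> R[i]) (h : parity)
    (x : R * R * R) :
  (forall y, k (flip h y) = k y) -> convolvable k f (flip h x) ->
  convolvable k (f \o flip h) x /\
  convolve k (f \o flip h) x = convolve k f (flip h x).
Proof.
move=> k_flip convf.
have E : (fun y => (k (x - y))%:C%C * (f \o flip h) y)%R =
         (fun y => (k (flip h x - y))%:C%C * f y)%R \o flip h.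
  by apply/funext => y; rewrite /= -flipN -flipD k_flip.
rewrite /convolvable /convolve E.
exact: (cintegral_measure_preserving (measure_preserving_flip h) convf).
Qed.

End FlipVolume.

(** * Bilinearity of B *)

Section IntegralExtensionality.
Context {R : realType} d (T : measurableType d) (mu : {measure set T -> \bar R}).

Lemma eq_cintegral (D : set T) (f g : T -> R[i]) : {in D, f =1 g} ->
  cintegral mu D f = cintegral mu D g.
Proof. by move=> fg; congr Complex; apply: eq_Rintegral => y yD; rewrite fg. Qed.

Lemma eq_cintegrable (D : set T) (f g : T -> R[i]) : measurable D ->
  {in D, f =1 g} -> cintegrable mu D f -> cintegrable mu D g.
Proof.
move=> mD fg [fRe fIm].
by split; [move: fRe|move: fIm]; apply: eq_integrable => // y yD; rewrite fg.
Qed.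

End IntegralExtensionality.

Section Bilinearity.
Context {R : realType}.

Definition field_lincomb (I : finType) (c : I -> R) (w : I -> field R) : field R :=
  fun t x j => lincomb c (fun i y => w i t y j) x.

Lemma solenoidal_lincomb (I : finType) (c : I -> R) (w : I -> field R) :
  (forall i, solenoidal (w i)) -> solenoidal (field_lincomb c w).
Proof.
move=> solw t x t0.
have dw l i : pderivable l (fun y => w i t y l) x by have [] := solw i t x t0.
split=> [l|]; first by have [] := pderive_linear c (dw l).
transitivity (\sum_l \sum_i (c i)%:C%C * pderive l (fun y => w i t y l) x).
  by apply: eq_bigr => l _; have [] := pderive_linear c (dw l).
rewrite exchange_big big1 //= => i _; rewrite -mulr_sumr.
by have [_ ->] := solw i t x t0; rewrite mulr0.
Qed.

(** Combinations over pairs of indices reduce bilinearity to the linearity of the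
    operators that [B] applies to products of components. *)
Lemma lincombM (I J : finType) (T : Type) (c : I -> R) (d : J -> R)
    (f : I -> T -> R[i]) (g : J -> T -> R[i]) (y : T) :
  lincomb c f y * lincomb d g y =
  lincomb (fun p : I * J => c p.1 * d p.2) (fun p y => f p.1 y * g p.2 y) y.
Proof.
rewrite /lincomb mulr_suml.
under eq_bigr do rewrite mulr_sumr.
rewrite pair_bigA /=; apply: eq_bigr => p _.
by rewrite rmorphM /= mulrACA.
Qed.

Variables (I J : finType) (c : I -> R) (d : J -> R).
Variables (U : I -> field R) (V : J -> field R).
(** Every pair of terms is needed, since cross terms of the two combinations
    interact. *)
Hypothesis wdUV : forall i j, B_well_defined (U i) (V j).
(** The derivatives of the [V j] are only known to exist as part of the
    well-definedness of [B] on a pair, so at least one first argument is needed. *)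
Hypothesis i0 : I.

Let cd (p : I * J) := c p.1 * d p.2.
Let u := field_lincomb c U.
Let v := field_lincomb d V.

Let wd1 (p : I * J) s x (s0 : 0 < s) :
  let: (u, v) := (U p.1, V p.2) in
  [/\ forall l j : 'I_3, pderivable l (fun y => v s y j) x,
      forall l m : 'I_3, pderivable m (fun y => u s y l * v s y m) x,
      forall l m : 'I_3, pderivable l (pderive m (fun y => u s y l * v s y m)) x
    & forall j : 'I_3, pderivable j (Gterm u v s) x].
Proof. by have [+ _ _ _] := wdUV p.1 p.2; exact. Qed.

Lemma pderive_field_lincomb s x l j : 0 < s -> pderivable l (fun y => v s y j) x /\
  pderive l (fun y => v s y j) x =
  \sum_k (d k)%:C%C * pderive l (fun y => V k s y j) x.
Proof.
move=> s0; apply: (pderive_linear d (f := fun k y => V k s y j)) => k.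
by have [dv _ _ _] := wd1 (i0, k) x s0; exact: dv.
Qed.

Lemma product_lincomb s l m : (fun y => u s y l * v s y m) =
  lincomb cd (fun p y => U p.1 s y l * V p.2 s y m).
Proof. by apply/funext => y; rewrite /u /v /field_lincomb lincombM. Qed.

(** Equalities such as this one hold at every point of space, so that they can be
    turned into equalities of functions and differentiated again. *)
Lemma pderive_product s l m x : 0 < s ->
  pderivable m (fun y => u s y l * v s y m) x /\
  pderive m (fun y => u s y l * v s y m) x =
  lincomb cd (fun p => pderive m (fun y => U p.1 s y l * V p.2 s y m)) x.
Proof.
move=> s0; rewrite product_lincomb; apply: (pderive_linear cd) => p.
by have [_ + _ _] := wd1 p x s0; exact.
Qed.

Lemma pderive2_product s l m x : 0 < s ->
  pderivable l (pderive m (fun y => u s y l * v s y m)) x /\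
  pderive l (pderive m (fun y => u s y l * v s y m)) x =
  lincomb cd (fun p => pderive l (pderive m (fun y => U p.1 s y l * V p.2 s y m))) x.
Proof.
move=> s0.
have -> : pderive m (fun y => u s y l * v s y m) =
    lincomb cd (fun p => pderive m (fun y => U p.1 s y l * V p.2 s y m)).
  by apply/funext => y; have [] := pderive_product l m y s0.
apply: (pderive_linear cd) => p.
by have [_ _ + _] := wd1 p x s0; exact.
Qed.

Lemma Gterm_lincomb s : 0 < s ->
  Gterm u v s = lincomb cd (fun p => Gterm (U p.1) (V p.2) s).
Proof.
move=> s0; apply/funext => x.
transitivity (\sum_(l < 3) \sum_(m < 3) lincomb cd (fun p =>
    pderive l (pderive m (fun y => U p.1 s y l * V p.2 s y m))) x).
  apply: eq_bigr => l _; apply: eq_bigr => m _.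
  exact: (pderive2_product l m x s0).2.
rewrite /lincomb; under eq_bigr => l _ do rewrite exchange_big.
rewrite exchange_big /=; apply: eq_bigr => p _.
by rewrite mulr_sumr; apply: eq_bigr => l _; rewrite mulr_sumr.
Qed.

Lemma pderive_Gterm_lincomb s j x : 0 < s ->
  pderivable j (Gterm u v s) x /\
  pderive j (Gterm u v s) x =
  lincomb cd (fun p => pderive j (Gterm (U p.1) (V p.2) s)) x.
Proof.
move=> s0; rewrite Gterm_lincomb //; apply: (pderive_linear cd) => p.
by have [_ _ _ +] := wd1 p x s0; exact.
Qed.

Lemma inv_neg_laplacian_lincomb s j x : 0 < s ->
  convolvable (@newton_kernel R) (pderive j (Gterm u v s)) x /\
  inv_neg_laplacian (pderive j (Gterm u v s)) x =
  lincomb cd (fun p => inv_neg_laplacian (pderive j (Gterm (U p.1) (V p.2) s))) x.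
Proof.
move=> s0.
have E : pderive j (Gterm u v s) =
    lincomb cd (fun p => pderive j (Gterm (U p.1) (V p.2) s)).
  by apply/funext => y; have [] := pderive_Gterm_lincomb j y s0.
have conv p : convolvable (@newton_kernel R)
    (pderive j (Gterm (U p.1) (V p.2) s)) x.
  by have [_ + _ _] := wdUV p.1 p.2; exact.
by have := convolve_linear cd conv; rewrite -E.
Qed.

Lemma proj_div_lincomb s j : 0 < s ->
  (fun y => proj_div u v s y j) =
  lincomb cd (fun p y => proj_div (U p.1) (V p.2) s y j).
Proof.
move=> s0; apply/funext => x.
transitivity (\sum_(l < 3) lincomb cd (fun p y =>
      U p.1 s y l * pderive l (fun y => V p.2 s y j) y) x +
    lincomb cd (fun p => inv_neg_laplacian (pderive j (Gterm (U p.1) (V p.2) s))) x).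
  congr (_ + _); last by have [] := inv_neg_laplacian_lincomb j x s0.
  apply: eq_bigr => l _.
  rewrite -(lincombM c d (fun i y => U i s y l)
    (fun k => pderive l (fun y => V k s y j)) x).
  by congr (_ * _); have [] := pderive_field_lincomb x l j s0.
rewrite /lincomb exchange_big -big_split /=; apply: eq_bigr => p _.
by rewrite -mulr_sumr -mulrDr.
Qed.

Lemma heat_lincomb s t j x : 0 < s -> s < t ->
  convolvable (heat_kernel (t - s)) (fun y => proj_div u v s y j) x /\
  heat (t - s) (fun y => proj_div u v s y j) x =
  \sum_p (cd p)%:C%C * heat (t - s) (fun y => proj_div (U p.1) (V p.2) s y j) x.
Proof.
move=> s0 st.
have conv p : convolvable (heat_kernel (t - s))
    (fun y => proj_div (U p.1) (V p.2) s y j) x.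
  by have [_ _ + _] := wdUV p.1 p.2; exact.
by have := convolve_linear cd conv; rewrite -proj_div_lincomb.
Qed.

(** The heat flow only splits for times [s] strictly between 0 and [t], which is
    why the two integrands are compared on the domain of integration alone. *)
Lemma B_integral_lincomb t x j : 0 < t ->
  cintegrable (@lebesgue_measure R) `]0, t[
    (fun s => heat (t - s) (fun y => proj_div u v s y j) x) /\
  B u v t x j = \sum_p (cd p)%:C%C * B (U p.1) (V p.2) t x j.
Proof.
move=> t0.
have E : {in `]0, t[, lincomb cd
      (fun p s => heat (t - s) (fun y => proj_div (U p.1) (V p.2) s y j) x) =1
    (fun s => heat (t - s) (fun y => proj_div u v s y j) x)}.
  by move=> s /[!in_itv] /andP[s0 st]; rewrite (heat_lincomb j x s0 st).2.
have mD : measurable (`]0, t[ : set R) by [].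
have [] := cintegral_linear (mu := @lebesgue_measure R) mD cd
  (f := fun p s => heat (t - s) (fun y => proj_div (U p.1) (V p.2) s y j) x).
  by move=> p; have [_ _ _ +] := wdUV p.1 p.2; exact.
move=> int_uv B_uv; split.
  by apply: eq_cintegrable int_uv => // s /[!inE]; exact: E.
by rewrite -B_uv; apply: eq_cintegral => s /[!inE] sD; rewrite E.
Qed.

Lemma B_well_defined_lincomb : B_well_defined u v.
Proof.
split=> [s x s0|s x j s0|s t x j s0 st|t x j t0].
- split=> [l j|l m|l m|j].
  + exact: (pderive_field_lincomb x l j s0).1.
  + exact: (pderive_product l m x s0).1.
  + exact: (pderive2_product l m x s0).1.
  + exact: (pderive_Gterm_lincomb j x s0).1.
- exact: (inv_neg_laplacian_lincomb j x s0).1.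
- exact: (heat_lincomb j x s0 st).1.
- exact: (B_integral_lincomb x j t0).1.
Qed.

Lemma B_lincomb t x j : 0 < t ->
  B u v t x j = \sum_p (c p.1 * d p.2)%:C%C * B (U p.1) (V p.2) t x j.
Proof. by move=> t0; have [] := B_integral_lincomb x j t0. Qed.

End Bilinearity.

(** * Reflection equivariance of B *)

Section Equivariance.
Context {R : realType}.
Implicit Types (x : R * R * R) (h g : parity).

Lemma complex_sign (b : bool) : (-1) ^+ b = ((-1) ^+ b)%:C%C :> R[i].
Proof. by rewrite (rmorph_sign (real_complex R)). Qed.

Lemma pderive_scale_flip (c : R) (f : R * R * R -> R[i]) h l x :
  pderivable l f (flip h x) ->
  pderivable l (fun y => c%:C%C * f (flip h y)) x /\
  pderive l (fun y => c%:C%C * f (flip h y)) x =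
  (c * (-1) ^+ h l)%:C%C * pderive l f (flip h x).
Proof.
move=> /pderive_flip[df Df].
have [dcf Dcf] := partial_linear_scale c (@pderive_linear R l x) df.
by split; [exact: dcf|rewrite rmorphM -mulrA -Df; exact: Dcf].
Qed.

Lemma convolve_scale_flip (c : R) (k : R * R * R -> R) (f : R * R * R -> R[i]) h x :
  (forall y, k (flip h y) = k y) -> convolvable k f (flip h x) ->
  convolve k (fun y => c%:C%C * f (flip h y)) x = c%:C%C * convolve k f (flip h x).
Proof.
move=> k_flip /(convolve_flip k_flip)[cf Cf].
by have [_ Ccf] := partial_linear_scale c (@convolve_linear R k x) cf; rewrite -Cf.
Qed.

Variables (u v : field R) (h : parity).
Hypothesis wd : B_well_defined u v.

Let uh := reflect_field h u.
Let vh := reflect_field h v.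
Let sg l : R := (-1) ^+ h l.

Let sg2 l : sg l * sg l = 1.
Proof. by rewrite /sg -expr2 sqrr_sign. Qed.

Let wd1 s x (s0 : 0 < s) :
  [/\ forall l j : 'I_3, pderivable l (fun y => v s y j) x,
      forall l m : 'I_3, pderivable m (fun y => u s y l * v s y m) x,
      forall l m : 'I_3, pderivable l (pderive m (fun y => u s y l * v s y m)) x
    & forall j : 'I_3, pderivable j (Gterm u v s) x].
Proof. by have [+ _ _ _] := wd; exact. Qed.

Let reflectE (w : field R) s y j :
  reflect_field h w s y j = (sg j)%:C%C * w s (flip h y) j.
Proof. by rewrite /reflect_field complex_sign. Qed.

(** In this lemma and the next ones, each component index [j] of a reflected field
    and each derivative in the direction [l] contributes the signs [sg j] and
    [sg l]. Indices that are summed over occur twice and their signs square to 1;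
    only the sign of the free component index survives. *)
Lemma pderive_reflect s x l j : 0 < s ->
  pderive l (fun y => vh s y j) x =
  (sg j * sg l)%:C%C * pderive l (fun y => v s y j) (flip h x).
Proof.
move=> s0; have [dv _ _ _] := wd1 (flip h x) s0.
rewrite -(pderive_scale_flip (sg j) (dv l j)).2.
by apply: (congr1 (fun f => pderive l f x)); apply/funext => y; exact: reflectE.
Qed.

Lemma pderive_reflectM s x l m : 0 < s ->
  pderive m (fun y => uh s y l * vh s y m) x =
  (sg l)%:C%C * pderive m (fun y => u s y l * v s y m) (flip h x).
Proof.
move=> s0; have [_ duv _ _] := wd1 (flip h x) s0.
rewrite -[sg l]mulr1 -(sg2 m) mulrA.
rewrite -(pderive_scale_flip (sg l * sg m) (duv l m)).2.
apply: (congr1 (fun f => pderive m f x)); apply/funext => y.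
rewrite /uh /vh (reflectE u) (reflectE v) mulrACA rmorphM.
exact: erefl.
Qed.

Lemma Gterm_reflect s x : 0 < s -> Gterm uh vh s x = Gterm u v s (flip h x).
Proof.
move=> s0; have [_ _ dduv _] := wd1 (flip h x) s0.
apply: eq_bigr => l _; apply: eq_bigr => m _.
rewrite -[RHS]mul1r -[1](rmorph1 (real_complex R)) -(sg2 l).
rewrite -[RHS](pderive_scale_flip (sg l) (dduv l m)).2.
apply: (congr1 (fun f => pderive l f x)); apply/funext => y.
exact: pderive_reflectM.
Qed.

Lemma pderive_Gterm_reflect s x j : 0 < s ->
  pderive j (Gterm uh vh s) x = (sg j)%:C%C * pderive j (Gterm u v s) (flip h x).
Proof.
move=> s0; have [_ _ _ dG] := wd1 (flip h x) s0.
rewrite -[sg j]mul1r -(pderive_scale_flip 1 (dG j)).2.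
apply: (congr1 (fun f => pderive j f x)); apply/funext => y.
by rewrite rmorph1 mul1r; exact: Gterm_reflect.
Qed.

Lemma proj_div_reflect s x j : 0 < s ->
  proj_div uh vh s x j = (sg j)%:C%C * proj_div u v s (flip h x) j.
Proof.
move=> s0; rewrite /proj_div mulrDr; congr (_ + _).
  rewrite mulr_sumr; apply: eq_bigr => l _.
  rewrite pderive_reflect // /uh reflectE mulrACA mulrA -!rmorphM.
  by rewrite mulrCA sg2 mulr1 mulrA.
have [_ conv _ _] := wd.
rewrite -(convolve_scale_flip (sg j) (newton_kernel_flip h) (conv _ _ _ s0)).
apply: (congr1 (fun f => convolve _ f x)); apply/funext => y.
exact: pderive_Gterm_reflect.
Qed.

(** In short, [B (reflect_field h u) (reflect_field h v)] is
    [reflect_field h (B u v)]: advection and divergence commute with orthogonal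
    maps, and the heat and Newton kernels are radial. *)
Lemma B_reflect t x j : 0 < t ->
  B uh vh t x j = (sg j)%:C%C * B u v t (flip h x) j.
Proof.
move=> t0; have [_ _ conv intg] := wd.
have mD : measurable (`]0, t[ : set R) by [].
have [_ <-] := partial_linear_scale (sg j)
  (cintegral_linear (mu := @lebesgue_measure R) mD) (intg t (flip h x) j t0).
apply: eq_cintegral => s; rewrite inE /= in_itv /= => /andP[s0 st].
rewrite -(convolve_scale_flip (sg j) (heat_kernel_flip (t - s) h)
  (conv _ _ _ _ s0 st)).
apply: (congr1 (fun f => convolve _ f x)); apply/funext => y.
exact: proj_div_reflect.
Qed.

End Equivariance.

Section Reflections.
Context {R : realType}.
Implicit Types (h g : parity) (w : field R).

(** The law of the group of coordinate reflections. *)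
Definition parity_add g h : parity := [ffun l => g l (+) h l].

Lemma parity_addK h : involutive (parity_add ^~ h).
Proof. by move=> g; apply/ffunP => l; rewrite !ffunE addbK. Qed.

Lemma reflect_field0 w : reflect_field [ffun=> false] w = w.
Proof.
apply/funext => t; apply/funext => x; apply/funext => j.
by rewrite /reflect_field ffunE mul1r flip0.
Qed.

Lemma reflect_field_comp g h w :
  reflect_field h (reflect_field g w) = reflect_field (parity_add g h) w.
Proof.
apply/funext => t; apply/funext => x; apply/funext => j.
rewrite /reflect_field flip_comp ffunE mulrA signr_addb.
by rewrite [(-1) ^+ g j * _]mulrC.
Qed.

Lemma reflect_field_lincomb (I : finType) (c : I -> R) (W : I -> field R) h :
  reflect_field h (field_lincomb c W) =
  field_lincomb c (fun i => reflect_field h (W i)).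
Proof.
apply/funext => t; apply/funext => x; apply/funext => j.
rewrite /reflect_field /field_lincomb /lincomb mulr_sumr.
by apply: eq_bigr => i _; rewrite mulrCA.
Qed.

Lemma solenoidal_reflect w h : solenoidal w -> solenoidal (reflect_field h w).
Proof.
move=> solw t x t0; have [dw divw] := solw t (flip h x) t0.
have E l : (fun y => reflect_field h w t y l) =
    (fun y => ((-1) ^+ h l)%:C%C * w t (flip h y) l).
  by apply/funext => y; rewrite /reflect_field complex_sign.
split=> [l|]; first by rewrite E; have [] := pderive_scale_flip ((-1) ^+ h l) (dw l).
rewrite -[RHS]divw; apply: eq_bigr => l _.
by rewrite E (pderive_scale_flip _ (dw l)).2 -expr2 sqrr_sign mul1r.
Qed.

End Reflections.

(** * Characters of the reflection group *)

Section Characters.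
Context {R : realType}.
Implicit Types (a g h : parity).

Definition character a g : R := (-1) ^+ (\sum_(l < 3) g l * a l)%N.

Lemma character_prod a g : character a g = \prod_(l < 3) (-1) ^+ (g l && a l).
Proof.
by rewrite /character -prodrXr; apply: eq_bigr => l _; rewrite mulnb.
Qed.

Lemma characterC a g : character a g = character g a.
Proof. by rewrite !character_prod; apply: eq_bigr => l _; rewrite andbC. Qed.

Lemma characterD a g h : character a (parity_add g h) = character a g * character a h.
Proof.
rewrite !character_prod -big_split /=; apply: eq_bigr => l _.
by rewrite ffunE andb_addl signr_addb.
Qed.

Lemma character_basis j g : character [ffun l => l == j] g = (-1) ^+ g j.
Proof.
rewrite character_prod (bigD1 j) //= ffunE eqxx andbT big1 ?mulr1 // => l lj.
by rewrite ffunE (negbTE lj) andbF.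
Qed.

(** Orthogonality of characters: the sum factors over the coordinates, and a
    coordinate with [g l] true contributes [1 + (-1) = 0]. *)
Lemma sum_character g : \sum_a character a g = 2 ^+ 3 * (g == [ffun=> false])%:R.
Proof.
under eq_bigr do rewrite character_prod.
rewrite -(bigA_distr_bigA (fun l b => (-1) ^+ (g l && b))).
under eq_bigr do rewrite big_bool andbT andbF expr0.
have [->|] := eqVneq.
  by under eq_bigr do rewrite ffunE; rewrite prodr_const card_ord mulr1.
rewrite mulr0; have [|/forallPn[l gl] _] := boolP [forall l, ~~ g l].
  move=> /forallP g0 /eqP[]; apply/ffunP => l; rewrite ffunE.
  exact/negbTE/g0.
by rewrite (bigD1 l) //= (negbNE gl) expr1 addNr mul0r.
Qed.

End Characters.

(** * Symmetric parts of a field *)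

Section SymmetricPart.
Context {R : realType}.
Implicit Types (a g h : parity) (w : field R).

(** The projection of [w] on the isotypic component of the character [a] for the
    action of the eight reflections on vector fields. *)
Definition symmetric_part a w : field R :=
  field_lincomb (fun g => (2 ^+ 3)^-1 * character a g) (fun g => reflect_field g w).

(** The change of variables [g |-> parity_add g h] in the average over the group
    produces the factor [character a h]. The right-hand side is phrased as a
    combination with one term so that bilinearity of [B] applies to it. *)
Lemma reflect_symmetric_part a h w :
  reflect_field h (symmetric_part a w) =
  field_lincomb (fun _ : unit => character a h) (fun=> symmetric_part a w).
Proof.
rewrite /symmetric_part reflect_field_lincomb.
apply/funext => t; apply/funext => x; apply/funext => j.
rewrite /field_lincomb /lincomb big_const card_unit /= addr0.
rewrite (reindex_inj (inv_inj (parity_addK h))) /= mulr_sumr.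
apply: eq_bigr => g _.
rewrite reflect_field_comp parity_addK characterD [RHS]mulrA -rmorphM.
by rewrite [character a h * _]mulrC -mulrA.
Qed.

(** Exchanging the two sums, orthogonality of characters kills every reflection
    except the identity. *)
Lemma sum_symmetric_part w :
  field_lincomb (fun _ : parity => 1) (fun a => symmetric_part a w) = w.
Proof.
apply/funext => t; apply/funext => x; apply/funext => j.
rewrite /symmetric_part /field_lincomb /lincomb.
under eq_bigr do rewrite rmorph1 mul1r.
rewrite exchange_big /=.
under eq_bigr do rewrite -mulr_suml -rmorph_sum -mulr_sumr sum_character
  mulKf ?expf_neq0 ?pnatr_eq0 //.
rewrite (bigD1 [ffun=> false]) //= eqxx rmorph1 mul1r reflect_field0.
by rewrite big1 ?addr0 // => g /negbTE ->; rewrite rmorph0 mul0r.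
Qed.

(** A field that every reflection multiplies by a character has symmetric
    components: reflecting the vector value itself costs the sign [(-1) ^+ h j], so
    the [j]-th component has the parity of [a] shifted by the [j]-th basis
    vector. The factor is real, hence acts separately on real and imaginary
    parts. *)
Lemma symmetric_field_reflect a w :
  (forall h t x j, 0 < t -> reflect_field h w t x j = (character a h)%:C%C * w t x j) ->
  symmetric_field w.
Proof.
move=> wE.
have flipE h t x j : 0 < t -> w t (flip h x) j =
    (character (parity_add a [ffun l => l == j]) h)%:C%C * w t x j.
  move=> t0.
  rewrite characterC characterD !(characterC h) character_basis.
  rewrite [character a h * _]mulrC rmorphM.
  rewrite -mulrA -wE // /reflect_field complex_sign.
  by rewrite mulrA -rmorphM -expr2 sqrr_sign rmorph1 mul1r.
by move=> j; split; exists (parity_add a [ffun l => l == j]) => h t x t0;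
  rewrite flipE // -/(character _ h); case: (w t x j) => p q /=;
  rewrite mul0r ?subr0 ?addr0.
Qed.

End SymmetricPart.

Theorem theorem4p8 (R : realType) (u v : field R)
    (hu : solenoidal u) (hv : solenoidal v)
    (hB : forall g g' : parity,
        B_well_defined (reflect_field g u) (reflect_field g' v)) :
  exists ua va : parity -> field R,
    [/\ (forall a : parity, symmetric_field (ua a) /\ solenoidal (ua a)),
        (forall a : parity, symmetric_field (va a) /\ solenoidal (va a)),
        (forall (t : R) (x : R * R * R) (j : 'I_3), 0 < t ->
           u t x j = \sum_(a : parity) ua a t x j /\
           v t x j = \sum_(a : parity) va a t x j),
        (forall a a' : parity,
           B_well_defined (ua a) (va a') /\ symmetric_field (B (ua a) (va a')))
      & (forall (t : R) (x : R * R * R) (j : 'I_3), 0 < t ->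
           B u v t x j =
           \sum_(a : parity) \sum_(a' : parity)
             B (ua a) (va a') t x j)].
Proof.
pose ua a := symmetric_part a u; pose va a := symmetric_part a v.
pose id0 : parity := [ffun=> false].
have part_sym w a : solenoidal w ->
    symmetric_field (symmetric_part a w) /\ solenoidal (symmetric_part a w).
  move=> solw; split.
    apply: (symmetric_field_reflect (a := a)) => h t x j _.
    rewrite reflect_symmetric_part /field_lincomb /lincomb.
    by rewrite big_const card_unit /= addr0.
  by apply: solenoidal_lincomb => g; exact: solenoidal_reflect.
have sumE w t x j : w t x j = \sum_a symmetric_part a w t x j.
  rewrite -[in LHS](sum_symmetric_part w) /field_lincomb /lincomb.
  by apply: eq_bigr => a _; rewrite rmorph1 mul1r.
have wd a a' : B_well_defined (ua a) (va a').
  exact: (B_well_defined_lincomb _ _ hB id0).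
exists ua, va; split=> //.
- by move=> a; exact: part_sym.
- by move=> a; exact: part_sym.
- move=> a a'; split=> //.
  apply: (symmetric_field_reflect (a := parity_add a a')) => h t x j t0.
  (* By equivariance, reflecting B (ua a) (va a') reflects both arguments, which
     multiplies them by their characters; these come out by bilinearity. *)
  rewrite /reflect_field complex_sign -B_reflect //.
  rewrite !reflect_symmetric_part.
  rewrite (B_lincomb _ _ (fun=> fun=> wd a a') tt) //.
  rewrite [in RHS]characterC characterD !(characterC h).
  by rewrite big_const card_prod card_unit /= addr0.
- move=> t x j t0.
  rewrite -{1}(sum_symmetric_part u) -{1}(sum_symmetric_part v).
  rewrite (B_lincomb _ _ wd id0) // pair_bigA /=.
  by apply: eq_bigr => p _; rewrite mulr1 rmorph1 mul1r.
Qed.
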